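(* Let $n \geq 7$ be an integer and let $Q_n$ be the $n$-dimensional hypercube graph. Then $b_2(Q_n) = n-1$.
   Context: All graphs are finite, simple and undirected. The hypercube $Q_n$ has vertex set the power set of $[n]=\{1,\dots,n\}$, with $u,v$ adjacent iff $|u\Delta v|=1$. $k$-liminal burning game on $G$ ($k$ a positive integer): two players, Saboteur and Arsonist. Each vertex is burned or unburned, and revealed or unrevealed; initially all are unburned and unrevealed. In each round: (i) propagation: every unburned vertex with a neighbor burned in an earlier round becomes burned (whether revealed or not); (ii) the Saboteur reveals $k$ vertices that are unrevealed and unburned (all such vertices if fewer than $k$ exist); revealed vertices stay revealed; (iii) the Arsonist burns one revealed unburned vertex (revealed in this or any earlier round), if one exists. The game ends in the round in which all vertices are burned. The Saboteur maximizes and the Arsonist minimizes the number of rounds; $b_k(G)$ is the number of rounds under optimal play. *)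

(* Defs.v *)
From mathcomp Require Import all_boot.

Set Implicit Arguments.
Unset Strict Implicit.
Unset Printing Implicit Defensive.

(* A finite simple graph is given by a symmetric irreflexive adjacency relation
   [e] on a finType [V]. *)

Section LiminalBurning.

Variables (V : finType) (e : rel V) (k : nat).
Implicit Types (B R S C : {set V}).

(* A position between two rounds is a pair (B, R) of the sets of burned and of
   revealed vertices. *)

Definition propagate B : {set V} := B :|: [set v | [exists u in B, e u v]].

(* In [reveals] and [burns], B is the burned set after the propagation step. *)
Definition reveals B R : {set {set V}} :=
  let U := ~: (B :|: R) in
  [set S : {set V} | (S \subset U) && (#|S| == minn k #|U|)].

(* The possible burned sets at the end of the round; here R already contains
   the newly revealed vertices.  The Arsonist passes only if he has to. *)
Definition burns B R : {set {set V}} :=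
  if R :\: B == set0 then [set B] else [set v |: B | v in R :\: B].

(* Minimax number of remaining rounds, truncated at m.  The default value m of
   the minimum is an upper bound of all the terms, and [burns] is never empty. *)
Fixpoint rounds_upto (m : nat) B R : nat :=
  if m isn't m'.+1 then 0
  else if B == setT then 0
  else (\max_(S in reveals (propagate B) R)
          \big[minn/m']_(C in burns (propagate B) (R :|: S))
             rounds_upto m' C (R :|: S)).+1.

(* If k > 0 then every round burns at least one new vertex, so #|~: B| rounds
   suffice and the truncation is vacuous: see [game_roundsE]. *)
Definition game_rounds B R : nat := rounds_upto #|~: B| B R.

Definition liminal_burning_number : nat := game_rounds set0 set0.

Lemma rounds_upto_le m B R : rounds_upto m B R <= m.
Proof.
elim: m B R => //= m IHm B R; case: ifP => // _.
rewrite ltnS; apply/bigmax_leqP => S _.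
by elim/big_rec: _ => // C x _ le_xm; rewrite geq_min le_xm orbT.
Qed.

Lemma reveals_neq0 B R : exists S, S \in reveals B R.
Proof.
have /card_geqP[s [us ss sU]] : minn k #|~: (B :|: R)| <= #|~: (B :|: R)|.
  exact: geq_minr.
exists [set x in s]; rewrite inE cardsE (card_uniqP us) ss eqxx andbT.
by apply/subsetP=> x; rewrite inE => /sU.
Qed.

Lemma burns_neq0 B R : exists C, C \in burns B R.
Proof.
rewrite /burns; case: ifP => [_|/negbT/set0Pn[v vRB]].
  by exists B; rewrite inE.
by exists (v |: B); apply: imset_f.
Qed.

Lemma burns_progress B R S C : 0 < k -> B != setT ->
  S \in reveals (propagate B) R -> C \in burns (propagate B) (R :|: S) ->
  #|~: C| < #|~: B|.
Proof.
move=> k_gt0 BnT; rewrite inE /burns => /andP[sSU /eqP cS].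
have sB : B \subset propagate B by apply: subsetUl.
suff H : (R :|: S) :\: propagate B == set0 -> propagate B = setT.
  case: ifP => [/H -> | _ /imsetP[v]].
    rewrite inE => /eqP ->.
    by rewrite setCT cards0 card_gt0; apply: contra BnT => /eqP E;
       rewrite -(setCK B) E setC0.
  rewrite inE => /andP[vB _] ->; apply: proper_card; rewrite properC.
  apply/properP; split; first exact: subset_trans sB (subsetUr _ _).
  by exists v; [rewrite setU11 | apply: contra vB => /(subsetP sB)].
move=> /eqP RS0; apply/eqP; rewrite -subTset; apply/subsetP=> v _.
apply/contraT => vB.
have RSB u : u \in R :|: S -> u \in propagate B.
  by move=> uRS; apply: contraT => uB; rewrite -(in_set0 u) -RS0 in_setD uB.
have vU : v \in ~: (propagate B :|: R).
  rewrite in_setC in_setU (negPf vB) /=; apply: contra vB => vR.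
  by apply: RSB; rewrite in_setU vR.
have : 0 < #|S| by rewrite cS leq_min k_gt0 card_gt0; apply/set0Pn; exists v.
rewrite card_gt0 => /set0Pn[u uS].
have := subsetP sSU u uS; rewrite in_setC in_setU negb_or.
by rewrite RSB // in_setU uS orbT.
Qed.

Lemma bigmin_default (I : finType) (P : pred I) (F : I -> nat) d1 d2 i0 :
  P i0 -> F i0 <= d1 -> F i0 <= d2 ->
  \big[minn/d1]_(i | P i) F i = \big[minn/d2]_(i | P i) F i.
Proof.
move=> Pi0 l1 l2.
have le d r : i0 \in r -> \big[minn/d]_(i <- r | P i) F i <= F i0.
  elim: r => // i r IHr; rewrite inE big_cons => /predU1P[<-|/IHr le_r].
    by rewrite Pi0 geq_minl.
  by case: (P i); rewrite // geq_min le_r orbT.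
rewrite -(minn_idPr (le d1 _ (mem_index_enum i0))).
rewrite -(minn_idPr (le d2 _ (mem_index_enum i0))).
elim/big_rec2: _ => [|i x y _ xy]; first by rewrite (minn_idPl l1) (minn_idPl l2).
by rewrite minnCA xy minnCA.
Qed.

Lemma rounds_upto_stable m B R : 0 < k -> #|~: B| <= m ->
  rounds_upto m B R = game_rounds B R.
Proof.
rewrite /game_rounds => k_gt0.
suff H m1 m2 B' R' : #|~: B'| <= m1 -> #|~: B'| <= m2 ->
    rounds_upto m1 B' R' = rounds_upto m2 B' R' by move/H; apply.
have z B0 : #|~: B0| <= 0 -> B0 == setT.
  by rewrite leqn0 cards_eq0 => /eqP E; rewrite -(setCK B0) E setC0.
elim: m1 m2 B' R' => [|m1 IHm] [|m2] B' R' //=.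
- by move=> /z ->.
- by move=> _ /z ->.
move=> le1 le2; case: ifP => // /negbT BnT; congr _.+1.
apply: eq_bigr => S SR.
have lt C : C \in burns (propagate B') (R' :|: S) ->
    (#|~: C| <= m1) * (#|~: C| <= m2).
  by move=> /(burns_progress k_gt0 BnT SR) ltC;
     split; rewrite -ltnS; apply: leq_trans ltC _.
have [C0 C0P] := burns_neq0 (propagate B') (R' :|: S).
rewrite (bigmin_default (d2 := m2) C0P) ?rounds_upto_le //; last first.
  by rewrite (IHm m2) ?lt // rounds_upto_le.
by apply: eq_bigr => C /lt ltC; rewrite (IHm m2) ?ltC.
Qed.

Lemma game_roundsE B R : 0 < k ->
  game_rounds B R =
  if B == setT then 0
  else (\max_(S in reveals (propagate B) R)
          \big[minn/#|V|]_(C in burns (propagate B) (R :|: S))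
             game_rounds C (R :|: S)).+1.
Proof.
move=> k_gt0; rewrite -(@rounds_upto_stable #|V|.+1) //=; last first.
  exact: leq_trans (max_card _) _.
case: ifP => // _; congr _.+1; apply: eq_bigr => S _; apply: eq_bigr => C _.
by rewrite rounds_upto_stable // max_card.
Qed.

End LiminalBurning.

(* The ground set [n] is represented by 'I_n. *)
Definition hypercube (n : nat) : rel {set 'I_n} :=
  fun u v => #|(u :\: v) :|: (v :\: u)| == 1.

Lemma hypercube_sym n : symmetric (@hypercube n).
Proof. by move=> u v; rewrite /hypercube setUC. Qed.

Lemma hypercube_irr n : irreflexive (@hypercube n).
Proof. by move=> u; rewrite /hypercube setDv setU0 cards0. Qed.

(* Main.v *)
Require Import Defs.
From mathcomp Require Import all_boot zify.

(* Write d for the Hamming distance.  A vertex burned in round j has burned its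
   ball of radius i - j by the end of round i.

   Lower bound.  Fix the vertex w = [n].  The Saboteur reveals in round t a
   prescribed pair of sets, of size t in the first half of the game and t + 1 in
   the second half, such that no set of the first (resp. second) half contains
   an earlier one of the same half.  Then no choice of the Arsonist ever burns a
   set planned for a later round, and w lies at distance at least n - 1 - t from
   both sets of round t, so that w is unburned after round n - 2.

   Upper bound.  Let v_1, v_2, ... be the vertices burned by the Arsonist, with
   v_1 translated to the empty set, so that d(v_j, v_i) > i - j for j < i, and
   |v_j| >= j for j > 1.  A vertex that v_1, ..., v_i do not burn by the end of
   round n - 1 is the antipode of a candidate u with d(u, v_j) <= j for all
   j <= i, in particular |u| <= 1.  At most two candidates are left after v_3.
   When two are left, v_1, ..., v_4 determine the only vertex that could be
   burned in round n - 2 >= 5 without eliminating one of them.  The Saboteur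
   reveals two, so the Arsonist, playing arbitrarily until then, can eliminate a
   candidate in round n - 2, and at most one vertex is left to burn in round
   n - 1. *)

(** * Hamming distance and cardinality *)

Definition symdiff {T : finType} (A B : {set T}) := (A :\: B) :|: (B :\: A).

Notation dist A B := #|symdiff A B|.

Lemma in_symdiff {T : finType} (A B : {set T}) x :
  (x \in symdiff A B) = (x \in A) (+) (x \in B).
Proof. by rewrite !inE; case: (x \in A); case: (x \in B). Qed.

Lemma symdiffC {T : finType} (A B : {set T}) : symdiff A B = symdiff B A.
Proof. by rewrite /symdiff setUC. Qed.

Lemma symdiffKr {T : finType} (C A B : {set T}) :
  symdiff (symdiff A C) (symdiff B C) = symdiff A B.
Proof. by apply/setP=> x; rewrite !in_symdiff addbACA addbb addbF. Qed.

Lemma symdiffxx {T : finType} (A : {set T}) : symdiff A A = set0.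
Proof. by rewrite /symdiff setDv setU0. Qed.

Lemma symdiffK {T : finType} (A B : {set T}) : symdiff (symdiff A B) B = A.
Proof. by apply/setP=> x; rewrite !in_symdiff addbK. Qed.

Lemma symdiffCl {T : finType} (A B : {set T}) :
  symdiff (~: A) B = ~: symdiff A B.
Proof. by apply/setP=> x; rewrite in_setC !in_symdiff in_setC addNb. Qed.

Lemma dist_eq0 {T : finType} (A B : {set T}) : (dist A B == 0) = (A == B).
Proof.
apply/idP/eqP=> [|->]; last by rewrite symdiffxx cards0.
rewrite cards_eq0 => /eqP/setP E; apply/setP=> x; move: (E x).
by rewrite in_symdiff inE; case: (x \in A); case: (x \in B).
Qed.

Lemma dist_triangle {T : finType} (B A C : {set T}) :
  dist A C <= dist A B + dist B C.
Proof.
apply: leq_trans (leq_card_setU _ _); apply/subset_leq_card/subsetP=> x.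
rewrite in_setU !in_symdiff.
by case: (x \in A); case: (x \in B); case: (x \in C).
Qed.

Lemma dist_subset {T : finType} (A B : {set T}) :
  A \subset B -> dist A B + #|A| = #|B|.
Proof.
move=> sAB; have /eqP sD : A :\: B == set0 by rewrite setD_eq0.
by rewrite /symdiff sD set0U -(cardsID A B) (setIidPr sAB) addnC.
Qed.

(** Lets arithmetic turn a failed inclusion into extra distance, two units per missing point, beyond
    the difference of the sizes. *)
Lemma dist_cardD {T : finType} (A B : {set T}) :
  #|B| + 2 * #|A :\: B| = dist A B + #|A|.
Proof.
rewrite /symdiff cardsU; have -> : (A :\: B) :&: (B :\: A) = set0.
  by apply/setP=> x; rewrite !inE; case: (x \in A); case: (x \in B).
rewrite cards0 subn0 -(cardsID A B) -(cardsID B A) setIC; lia.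
Qed.

Lemma dist_setCl {T : finType} (A B : {set T}) :
  dist (~: A) B + dist A B = #|T|.
Proof. by rewrite symdiffCl addnC cardsC. Qed.

Lemma dist_step {T : finType} (A B : {set T}) d :
  dist A B = d.+1 -> exists2 C, dist A C = d & dist C B = 1.
Proof.
move=> dAB; have /set0Pn[c cAB] : symdiff A B != set0.
  by rewrite -card_gt0 dAB.
exists (symdiff [set c] B); last first.
  by rewrite symdiffK cards1.
move: dAB; rewrite (cardsD1 c) cAB => -[<-]; congr #|pred_of_set _|.
apply/setP=> x; move: cAB; rewrite in_setD1 !in_symdiff in_set1.
by case: eqP => [->|_]; case: (_ \in A); case: (_ \in B).
Qed.

Lemma propagate_hypercubeP n (B : {set {set 'I_n}}) x :
  reflect (exists2 y, y \in B & dist y x <= 1)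
          (x \in propagate (@hypercube n) B).
Proof.
rewrite in_setU in_set; apply: (iffP orP) => [[xB|]|[y yB]].
- by exists x; rewrite // symdiffxx cards0.
- by case/existsP=> y /andP[yB /eqP e]; exists y; rewrite // /symdiff e.
rewrite leq_eqVlt ltnS leqn0 dist_eq0 => /orP[e|/eqP <-]; last by left.
by right; apply/existsP; exists y; rewrite yB.
Qed.

(** * Saboteur *)

(** Invariant after [i] rounds: the burned vertices lie in balls of radius [i - j - 1] around sets
    planned for rounds [j < i], counted from 0, and only such sets have been revealed. While
    [i <= T], the vertex [w] is outside all these balls. *)
Lemma saboteur_scheme n T (z : nat -> bool -> {set 'I_n}) (w : {set 'I_n}) :
    (forall t, t < T -> z t false != z t true) ->
    (forall s t b c, s < t -> t < T -> t - s < dist (z s b) (z t c)) ->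
    (forall t b, t < T -> T - t <= dist (z t b) w) ->
  forall i m (B R : {set {set 'I_n}}), i <= T -> T - i < m ->
    (forall x, x \in B -> exists j b, dist (z j b) x + j < i) ->
    (forall x, x \in R -> exists j b, j < i /\ x = z j b) ->
  T - i < rounds_upto (@hypercube n) 2 m B R.
Proof.
move=> z_neq z_far w_far i m; move: {-2}(T - i) (leqnn (T - i)) => d.
elim: m i d => // m IHm i d d_le B R iT dm hB hR /=.
case: ifP => [/eqP BT|_].
  have [j [b]] := hB w ltac:(by rewrite BT inE).
  have := w_far j b; lia.
case: d => [|d] // in d_le dm *; rewrite ltnS.
have iT' : i < T by lia.
pose B' := propagate (@hypercube n) B.
have hB' x : x \in B' -> exists j b, j < i /\ dist (z j b) x + j < i.+1.
  case/propagate_hypercubeP=> y /hB[j [b ji]] yx; exists j, b.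
  by have := dist_triangle y (z j b) x; lia.
(* Propagation has enlarged the ball around [z j b] to radius [i - j], still less than its distance
   to [z i c]. *)
have zB' c : z i c \notin B'.
  by apply/negP=> /hB'[j [b [ji]]]; have := z_far j i b c ji iT'; lia.
have zR c : z i c \notin R.
  apply/negP=> /hR[j [b [ji e]]]; have := z_far j i b c ji iT'.
  by rewrite e symdiffxx cards0.
pose S := [set z i false; z i true].
have SU : S \subset ~: (B' :|: R).
  by apply/subsetP=> x /set2P[]->; rewrite in_setC in_setU negb_or zB' zR.
have cS : #|S| = 2 by rewrite cards2 z_neq.
have SR : S \in reveals 2 B' R.
  rewrite inE SU cS /=; apply/eqP; have := subset_leq_card SU.
  by rewrite cS => /minn_idPl.
apply: leq_trans (leq_bigmax_cond _ SR).
have hRS x : x \in R :|: S -> exists j b, j < i.+1 /\ x = z j b.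
  rewrite in_setU => /orP[/hR[j [b [ji ->]]]|].
    by exists j, b; rewrite ltnW.
  by case/set2P=> ->; [exists i, false | exists i, true].
(* The default value [m] of the minimum exceeds [d] too, by the assumption on the truncation. *)
elim/big_ind: _ => [|p q|C CB]; [lia | by rewrite leq_min => -> -> |].
apply: (IHm i.+1 d _ C (R :|: S) _ _ _ hRS); [lia | lia | lia |].
have hB1 x : x \in B' -> exists j b, dist (z j b) x + j < i.+1.
  by case/hB'=> j [b [_ ?]]; exists j, b.
move=> x; move: CB; rewrite /burns; case: ifP => _.
  by rewrite inE => /eqP ->; apply: hB1.
case/imsetP=> v /setDP[/hRS[j [b [ji ->]]] _] ->.
by case/setU1P=> [->|/hB1 //]; exists j, b; rewrite symdiffxx cards0.
Qed.

(** * The sets of the Saboteur's plan *)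

Lemma card_ord_set n (p : pred nat) :
  #|[set i : 'I_n | p i]| = count p (iota 0 n).
Proof.
rewrite cardsE -sum1_card -(big_mkord p (fun=> 1)) sum1_count.
by rewrite /index_iota subn0.
Qed.

(* For [s > 1] the two sets differ in the interval; for [s = 1] the interval is
   empty, whence the exception. *)
Definition staircase n s (b : bool) : {set 'I_n} :=
  [set i : 'I_n | (i == n - s.+1 + (b && (s == 1)) :> nat)
               || (b <= i < b + s.-1)].

Lemma card_staircase n s b : 0 < s -> 2 * s < n -> #|staircase n s b| = s.
Proof.
move=> s0 sn; pose t := n - s.+1 + (b && (s == 1)).
rewrite (card_ord_set n (fun i => (i == t) || (b <= i < b + s.-1))).
have tn : t < n by rewrite /t; lia.
have bt : b + s.-1 <= t by rewrite /t; lia.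
(* The count is generalized to all prefixes for the induction; by [bt] the isolated point is beyond
   the interval, so nothing is counted twice. *)
have -> : forall m, count (fun i => (i == t) || (b <= i < b + s.-1)) (iota 0 m)
     = (t < m) + (minn m (b + s.-1) - b).
  elim=> [|m IHm]; first by rewrite /= ; lia.
  by rewrite -addn1 iotaD count_cat IHm /= add0n; lia.
lia.
Qed.

Lemma staircase_neq n s : 0 < s -> 2 * s < n ->
  staircase n s false != staircase n s true.
Proof.
move=> s0 sn; apply/eqP=> /setP E.
case: (eqVneq s 1) => [s1|s1].
  have h : n - s.+1 < n by lia.
  have := E (Ordinal h); rewrite !inE /=; lia.
have h : 0 < n by lia.
have := E (Ordinal h); rewrite !inE /=; lia.
Qed.

(** The isolated point of the smaller set lies above every element of the larger one: isolated
    points descend as the size grows, and [2 * t < n] keeps the interval below them. *)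
Lemma staircase_nsub n s t b c : 0 < s -> s < t -> 2 * t < n ->
  ~~ (staircase n s b \subset staircase n t c).
Proof.
move=> s0 st tn; apply/subsetPn.
have h : n - s.+1 + (b && (s == 1)) < n by lia.
by exists (Ordinal h); rewrite !inE /=; lia.
Qed.

(** [t] counts from 0. Staircases are used for sizes below [n / 2]; past the middle, complements
    continue the growth, one size being skipped at the junction. *)
Definition reveal_scheme n t b : {set 'I_n} :=
  if 2 * t.+1 < n then staircase n t.+1 b else ~: staircase n (n - t.+2) b.

Lemma reveal_scheme_neq n t : t < n - 2 ->
  reveal_scheme n t false != reveal_scheme n t true.
Proof.
move=> tn; rewrite /reveal_scheme; case: ifP => h; last first.
  rewrite (inj_eq (@setC_inj _)).
all: by apply: staircase_neq; lia.
Qed.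

(** Within a half the sizes differ by [t - s], and non-inclusion adds to the distance; across the
    halves the skipped size adds one. Complements reverse inclusions, which fits the second half,
    where the later set has the smaller staircase. *)
Lemma reveal_scheme_far n s t b c : s < t -> t < n - 2 ->
  t - s < dist (reveal_scheme n s b) (reveal_scheme n t c).
Proof.
move=> st tn.
have dle := dist_cardD (reveal_scheme n s b) (reveal_scheme n t c).
move: dle; rewrite /reveal_scheme.
case: (ltnP (2 * s.+1)) => hs; case: (ltnP (2 * t.+1)) => ht.
- rewrite !card_staircase //.
  have := staircase_nsub n s.+1 t.+1 b c ltac:(by []) st ht.
  rewrite -setD_eq0 -cards_eq0; lia.
- have := cardsC (staircase n (n - t.+2) c).
  rewrite !card_staircase ?card_ord //; lia.
- lia.
have := cardsC (staircase n (n - t.+2) c).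
have := cardsC (staircase n (n - s.+2) b).
rewrite !card_staircase ?card_ord; try lia.
have := staircase_nsub n (n - t.+2) (n - s.+2) c b.
rewrite -setCS -setD_eq0 -cards_eq0; lia.
Qed.

Lemma reveal_scheme_setT n t b : t < n - 2 ->
  n - 2 - t <= dist (reveal_scheme n t b) setT.
Proof.
move=> tn; have := dist_subset _ _ (subsetT (reveal_scheme n t b)).
rewrite cardsT card_ord /reveal_scheme; case: ifP => h.
  by rewrite card_staircase //; lia.
have := cardsC (staircase n (n - t.+2) b).
by rewrite card_staircase ?card_ord; lia.
Qed.

Lemma liminal_burning_number_ge n :
  2 < n -> n - 1 <= liminal_burning_number (@hypercube n) 2.
Proof.
move=> n2; rewrite /liminal_burning_number /game_rounds.
have -> : n - 1 = (n - 2 - 0).+1 by lia.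
apply: (saboteur_scheme _ (n - 2) (reveal_scheme n) setT) => //.
- exact: reveal_scheme_neq.
- exact: reveal_scheme_far.
- by move=> t b; apply: reveal_scheme_setT.
(* The truncation is at [2 ^ n] rounds, which exceeds [n - 2]. *)
- have := ltn_expl n (isT : 1 < 2).
  have -> : #|~: (set0 : {set {set 'I_n}})| = 2 ^ n.
    by rewrite setC0 -powersetT card_powerset cardsT card_ord.
  lia.
- by move=> x; rewrite inE.
- by move=> x; rewrite inE.
Qed.

(** * Arsonist *)

Lemma disjoint_card1 {T : finType} (u v : {set T}) :
  #|u| <= 1 -> #|v| <= 1 -> u != v -> u :&: v = set0.
Proof.
move=> u1 v1; apply: contraNeq => /set0Pn[x /setIP[xu xv]].
have eqx (w : {set T}) : #|w| <= 1 -> x \in w -> w = [set x].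
  by move=> w1 xw; apply/esym/eqP; rewrite eqEcard sub1set xw cards1.
by rewrite (eqx u) // (eqx v).
Qed.

(** A point of [u] outside [X] would make the distance [#|X| + 1], more than [i]. *)
Lemma candidate_sub {T : finType} i (u X : {set T}) : 1 < i ->
  #|u| <= 1 -> i <= #|X| -> dist u X <= i -> u \subset X /\ #|X| <= i + #|u|.
Proof.
move=> i1 u1 iX duX.
suff uX : u \subset X by split=> //; have := dist_subset _ _ uX; lia.
rewrite -setD_eq0 -cards_eq0; have := dist_cardD u X.
lia.
Qed.

(** [X1] and [X2] stand for the translates of v_2 and v_3. At most one candidate is empty, so the
    bounds on [X1] force it to be the union of the three; [X2] then contains [X1] and at most one
    more point, hence is too close to it. *)
Lemma at_most_two_candidates {T : finType} (u1 u2 u3 X1 X2 : {set T}) :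
    #|u1| <= 1 -> #|u2| <= 1 -> #|u3| <= 1 ->
    u1 != u2 -> u2 != u3 -> u3 != u1 ->
    2 <= #|X1| -> 3 <= #|X2| -> 2 <= dist X1 X2 ->
    dist u1 X1 <= 2 -> dist u2 X1 <= 2 -> dist u3 X1 <= 2 ->
    dist u1 X2 <= 3 -> dist u2 X2 <= 3 -> dist u3 X2 <= 3 ->
  False.
Proof.
move=> c1 c2 c3 n12 n23 n31 X1ge X2ge dX d11 d21 d31 d12 d22 d32.
have [s11 l11] := candidate_sub 2 _ _ isT c1 X1ge d11.
have [s21 l21] := candidate_sub 2 _ _ isT c2 X1ge d21.
have [s31 l31] := candidate_sub 2 _ _ isT c3 X1ge d31.
have [s12 l12] := candidate_sub 3 _ _ isT c1 X2ge d12.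
have [s22 l22] := candidate_sub 3 _ _ isT c2 X2ge d22.
have [s32 l32] := candidate_sub 3 _ _ isT c3 X2ge d32.
have neq0 (u v : {set T}) : u != v -> 0 < #|u| + #|v|.
  apply: contraNT; rewrite -leqNgt leqn0 addn_eq0 !cards_eq0.
  by case/andP=> /eqP-> /eqP->.
have cK : #|u1 :|: u2 :|: u3| = #|u1| + #|u2| + #|u3|.
  rewrite cardsU setIUl (disjoint_card1 u1 u3) // 1?eq_sym //.
  rewrite (disjoint_card1 u2 u3) // setU0 cards0 subn0.
  by rewrite cardsU (disjoint_card1 u1 u2) // cards0 subn0.
have K1 : u1 :|: u2 :|: u3 \subset X1 by rewrite !subUset s11 s21.
have K2 : u1 :|: u2 :|: u3 \subset X2 by rewrite !subUset s12 s22.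
have X1K : #|X1| <= #|u1 :|: u2 :|: u3|.
  have := neq0 _ _ n12; have := neq0 _ _ n23; have := neq0 _ _ n31.
  rewrite cK; clear -c1 c2 c3 l11 l21 l31; lia.
have X2K : #|X2| <= #|u1 :|: u2 :|: u3|.+1.
  have := neq0 _ _ n12; have := neq0 _ _ n23; have := neq0 _ _ n31.
  rewrite cK; clear -c1 c2 c3 l12 l22 l32; lia.
have E : u1 :|: u2 :|: u3 = X1 by apply/eqP; rewrite eqEcard K1.
rewrite E in K2 X2K; have := dist_subset _ _ K2.
clear -dX X2K; lia.
Qed.

(* [x] and [x'] are [M] minus one point each; a set between [K] and [M] inside
   neither contains both points. *)
Lemma squeezed_subset {T : finType} (K M Y Z x x' : {set T}) :
    x \subset M -> x' \subset M -> Y \subset M -> Z \subset M ->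
    K \subset x -> K \subset x' -> K \subset Y -> K \subset Z ->
    #|M| <= #|x|.+1 -> #|M| <= #|x'|.+1 -> x != x' -> #|Y| <= #|K| + 2 ->
    ~~ (Y \subset x) -> ~~ (Y \subset x') ->
    ~~ (Z \subset x) -> ~~ (Z \subset x') ->
  Y \subset Z.
Proof.
move=> xM x'M YM ZM Kx Kx' KY KZ cx cx' xx' cY Yx Yx' Zx Zx'.
have compl1 (v W : {set T}) : v \subset M -> W \subset M -> #|M| <= #|v|.+1 ->
    ~~ (W \subset v) -> exists2 p, M :\: v = [set p] & p \in W.
  move=> vM WM cv /subsetPn[p pW pv]; exists p => //.
  apply/esym/eqP; rewrite eqEcard sub1set inE pv (subsetP WM) // cards1.
  have := cardsID v M; rewrite (setIidPr vM); clear -cv; lia.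
have [p Ep pY] := compl1 x Y xM YM cx Yx.
have [p' Ep' p'Y] := compl1 x' Y x'M YM cx' Yx'.
have [q Eq qZ] := compl1 x Z xM ZM cx Zx.
have [q' Eq' q'Z] := compl1 x' Z x'M ZM cx' Zx'.
have epq : p = q by apply/set1P; rewrite -Eq Ep set11.
have epq' : p' = q' by apply/set1P; rewrite -Eq' Ep' set11.
have px : p \notin x by have := set11 p; rewrite -Ep inE => /andP[].
have px' : p' \notin x' by have := set11 p'; rewrite -Ep' inE => /andP[].
have pp' : p != p'.
  have xE (v : {set T}) : v \subset M -> v = M :\: (M :\: v).
    by move=> vM; rewrite setDDr setDv set0U (setIidPr vM).
  by apply: contraNneq xx' => e; rewrite (xE x) // (xE x') // Ep Ep' e.
(* [Y] has at most two points more than [K], and [p], [p'] are two points of [Y] outside [K]. *)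
have EY : Y = K :|: [set p; p'].
  apply/esym/eqP; rewrite eqEcard !subUset KY !sub1set pY p'Y /=.
  rewrite cardsU cards2 pp'; have -> : K :&: [set p; p'] = set0; last first.
    by rewrite cards0 subn0.
  apply/setP=> a; rewrite !inE; apply/negP=> /andP[aK /orP[]/eqP e].
    by move: px; rewrite -e (subsetP Kx).
  by move: px'; rewrite -e (subsetP Kx').
by rewrite EY !subUset KZ !sub1set epq qZ epq' q'Z.
Qed.

Lemma dist_nsub {T : finType} (A B : {set T}) d :
  d <= dist A B -> #|B| < #|A| + d -> ~~ (A \subset B).
Proof. by move=> dAB; apply: contraL => /dist_subset E; lia. Qed.

Lemma card_sub_succ {T : finType} (K X : {set T}) :
  K \subset X -> #|X| = #|K|.+1 -> exists e, X = e |: K.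
Proof.
move=> KX cX; have : #|X :\: K| = 1.
  by have := cardsID K X; rewrite (setIidPr KX) cX; clear; lia.
move/eqP/cards1P=> [e Ee]; exists e.
by rewrite -(setID X K) (setIidPr KX) Ee setUC.
Qed.

(** [X1], [X2], [X3] stand for the translates of v_2, v_3, v_4, and [x], [x'] for two vertices that
    could be burned in round [n - 2] without eliminating [u] or [u']. All five sets contain
    [u :|: u']; the cases depend on how far [X1] and [X2] exceed it. *)
Lemma at_most_one_safe {T : finType} (u u' X1 X2 X3 x x' : {set T}) :
    7 <= #|T| -> #|u| <= 1 -> #|u'| <= 1 -> u != u' ->
    2 <= #|X1| -> 3 <= #|X2| -> 4 <= #|X3| ->
    2 <= dist X1 X2 -> 3 <= dist X1 X3 -> 2 <= dist X2 X3 ->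
    dist u X1 <= 2 -> dist u X2 <= 3 -> dist u X3 <= 4 ->
    dist u' X1 <= 2 -> dist u' X2 <= 3 -> dist u' X3 <= 4 ->
    (forall y, y \in [set x; x'] ->
      [/\ #|T| - 2 <= #|y|, #|T| - 3 <= dist X1 y, #|T| - 4 <= dist X2 y,
          #|T| - 5 <= dist X3 y &
          dist u y <= #|T| - 2 /\ dist u' y <= #|T| - 2]) ->
  x = x'.
Proof.
move=> T7 cu cu' uu' X1ge X2ge X3ge d12 d13 d23 u1 u2 u3 v1 v2 v3 hx.
have [us1 ul1] := candidate_sub 2 _ _ isT cu X1ge u1.
have [us2 ul2] := candidate_sub 3 _ _ isT cu X2ge u2.
have [us3 ul3] := candidate_sub 4 _ _ isT cu X3ge u3.
have [vs1 vl1] := candidate_sub 2 _ _ isT cu' X1ge v1.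
have [vs2 vl2] := candidate_sub 3 _ _ isT cu' X2ge v2.
have [vs3 vl3] := candidate_sub 4 _ _ isT cu' X3ge v3.
pose K := u :|: u'.
have [c [c1 cK X1le X2le X3le]] : exists c, [/\ c <= 1, #|K| = c.+1,
    #|X1| <= 2 + c, #|X2| <= 3 + c & #|X3| <= 4 + c].
  (* Distinct sets of size at most one are disjoint: [c] is 1 if both are singletons, 0 if one is
     empty. *)
  exists (minn #|u| #|u'|).
  have : 0 < #|u| + #|u'|.
    apply: contraNT uu'; rewrite -leqNgt leqn0 addn_eq0 !cards_eq0.
    by case/andP=> /eqP-> /eqP->.
  rewrite /K cardsU (disjoint_card1 u u') // cards0 subn0.
  clear -cu cu' ul1 ul2 ul3 vl1 vl2 vl3; split; lia.
have K1 : K \subset X1 by rewrite subUset us1.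
have K2 : K \subset X2 by rewrite subUset us2.
have K3 : K \subset X3 by rewrite subUset us3.
have hy y : y \in [set x; x'] -> [/\ K \subset y, #|T| - 2 <= #|y|,
    #|y| <= #|T| - 2 + c,
    (#|X3| + #|T| - 5 <= #|y| \/ ~~ (X3 \subset y)) &
    (#|X1| + #|T| - 3 <= #|y| \/ ~~ (X1 \subset y)) /\
    (#|X2| + #|T| - 4 <= #|y| \/ ~~ (X2 \subset y))].
  case/hx=> y2 y1' y2' y3' [uy vy].
  have i1 : 1 < #|T| - 2 by clear -T7; lia.
  have [us ul] := candidate_sub _ _ _ i1 cu y2 uy.
  have [vs vl] := candidate_sub _ _ _ i1 cu' y2 vy.
  have yle : #|y| <= #|T| - 2 + c.
    have := cK; rewrite /K cardsU (disjoint_card1 u u') // cards0 subn0.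
    clear -cu cu' ul vl; lia.
  have ns i (X : {set T}) : #|T| - i <= dist X y -> i <= 5 ->
      #|X| + #|T| - i <= #|y| \/ ~~ (X \subset y).
    move=> dXy i5; case: (boolP (X \subset y)); last by right.
    move/dist_subset=> E.
    by left; clear -E i5 dXy T7; lia.
  by split; rewrite ?subUset ?us //; [apply: ns | split; apply: ns].
have [Kx x2 xc x3 [x1' x2']] := hy x (set21 _ _).
have [Kx' x'2 x'c x'3 [x'1' x'2']] := hy x' (set22 _ _).
clear hx hy u1 u2 u3 v1 v2 v3 us1 us2 us3 vs1 vs2 vs3.
clear ul1 ul2 ul3 vl1 vl2 vl3.
case: (eqVneq x x') => // xx'; exfalso.
(* Unless it reaches [x = x'], each case below refutes this by showing [X2 \subset X3] with [X3] too
   small. *)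
have X23 : ~~ (X2 \subset X3) \/ #|X2| + 2 <= #|X3|.
  case: (boolP (X2 \subset X3)) => [/dist_subset E|]; last by left.
  by clear -d23 E; right; lia.
(* In the first case [X1 = K], so [x] and [x'] contain [X1] and miss at most one point:
   [squeezed_subset] applies with [setT] as [M]. *)
have [cX1|cX1] : #|X1| = c.+1 \/ #|X1| = c.+2 by clear -X1ge X1le c1; lia.
  have EK : K = X1 by apply/eqP; rewrite eqEcard K1 cX1 cK leqnn.
  have := dist_subset X1 X2; have := dist_subset X1 X3.
  rewrite -EK => /(_ K3) E3 /(_ K2) E2.
  rewrite EK in Kx Kx' E2 E3.
  case: x1' => [x1'|]; last by rewrite Kx.
  case: x'1' => [x'1'|]; last by rewrite Kx'.
  have X2x : ~~ (X2 \subset x).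
    case: x2' => // x2'; exfalso.
    by clear -E2 d12 x2' xc cX1 c1 T7; lia.
  have X2x' : ~~ (X2 \subset x').
    case: x'2' => // x'2'; exfalso.
    by clear -E2 d12 x'2' x'c cX1 c1 T7; lia.
  have X3x : ~~ (X3 \subset x).
    by case: x3 => // x3; exfalso; clear -E3 d13 x3 xc cX1 c1 T7; lia.
  have X3x' : ~~ (X3 \subset x').
    by case: x'3 => // x'3; exfalso; clear -E3 d13 x'3 x'c cX1 c1 T7; lia.
  have cT (y : {set T}) : #|X1| + #|T| - 3 <= #|y| -> #|[set: T]| <= #|y|.+1.
    by rewrite cardsT; clear -X1ge; lia.
  have X23s : X2 \subset X3.
    apply: (squeezed_subset K setT X2 X3 x x'); rewrite ?subsetT ?EK //.
    - by rewrite -EK.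
    - by rewrite -EK.
    - exact: cT.
    - exact: cT.
    - by clear -cX1 X2le; lia.
  case: X23; first by rewrite X23s.
  by clear -E2 d12 cX1 X3le; lia.
(* Otherwise [X1] adds one point [e] to [K], and [X2], [X3], [x], [x'] avoid [e] because none of
   them contains [X1]. *)
have [e Ee] := card_sub_succ K X1 K1 ltac:(by rewrite cK).
have eM (Y : {set T}) : K \subset Y -> ~~ (X1 \subset Y) ->
    Y \subset ~: [set e].
  move=> KY; rewrite Ee subUset KY andbT sub1set => eY.
  by rewrite subsetC sub1set inE.
have X2M : X2 \subset ~: [set e].
  by apply: eM => //; apply: dist_nsub d12 _; clear -X2le cX1; lia.
have X3M : X3 \subset ~: [set e].
  by apply: eM => //; apply: dist_nsub d13 _; clear -X3le cX1; lia.
have xM : x \subset ~: [set e].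
  apply: eM => //; case: x1' => // x1'; exfalso.
  by clear -x1' cX1 xc T7; lia.
have x'M : x' \subset ~: [set e].
  apply: eM => //; case: x'1' => // x'1'; exfalso.
  by clear -x'1' cX1 x'c T7; lia.
have cM : #|~: [set e]| = #|T| - 1 by rewrite cardsC1 subn1.
have [cX2|cX2] : #|X2| = c.+2 \/ #|X2| = c.+3 by clear -X2ge X2le c1; lia.
  have [f Ef] := card_sub_succ K X2 K2 ltac:(by rewrite cK).
  have ef : f != e.
    have : f \in ~: [set e] by rewrite (subsetP X2M) // Ef setU11.
    by rewrite !inE.
  (* Containing [f] means containing [X2], which forces [y] up to [~: [set e]]; avoiding [f] leaves
     only [~: [set e; f]]. The attached facts about [X3] make the two alternatives incompatible. *)
  have xE (y : {set T}) :
      K \subset y -> #|T| - 2 <= #|y| -> y \subset ~: [set e] ->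
      #|X2| + #|T| - 4 <= #|y| \/ ~~ (X2 \subset y) ->
      #|X3| + #|T| - 5 <= #|y| \/ ~~ (X3 \subset y) ->
      y = ~: [set e] /\ #|X3| <= 4 \/
      y = ~: [set e; f] /\ ~~ (X3 \subset ~: [set e; f]).
    move=> Ky y2 yM y2' y3'.
    have [fy|fy] := boolP (f \in y).
      left; have Ey : y = ~: [set e].
        apply/eqP; rewrite eqEcard yM cM.
        case: y2' => [y2'|]; last by rewrite Ef subUset Ky andbT sub1set fy.
        by clear -y2' X2ge; lia.
      split=> //; move: y3'; rewrite Ey X3M cM => -[y3'|//].
      by clear -y3' T7; lia.
    have cEF : #|~: [set e; f]| = #|T| - 2.
      by have := cardsC [set e; f]; rewrite cards2 eq_sym ef; clear; lia.
    right; have Ey : y = ~: [set e; f].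
      apply/eqP; rewrite eqEcard cEF y2 andbT.
      rewrite subsetC; apply/subsetP=> a /set2P[]->; rewrite inE //.
      by move: yM; rewrite subsetC sub1set inE.
    split=> //; move: y3'; rewrite Ey cEF => -[y3'|//].
    by clear -y3' T7 X3ge; lia.
  have X3f : #|X3| <= 4 -> ~~ (X3 \subset ~: [set e; f]) -> False.
    move=> X3le4; case/subsetPn=> a aX3; rewrite !inE negbK => /orP[]/eqP ea.
      by have := subsetP X3M a aX3; rewrite !inE ea eqxx.
    have X23s : X2 \subset X3 by rewrite Ef subUset K3 andbT sub1set -ea.
    case: X23; first by rewrite X23s.
    by clear -X3le4 X2ge; lia.
  have [[Ex cx]|[Ex cx]] := xE x Kx x2 xM x2' x3;
    have [[Ex' cx']|[Ex' cx']] := xE x' Kx' x'2 x'M x'2' x'3.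
  - by case/eqP: xx'; rewrite Ex Ex'.
  - exact: X3f.
  - exact: X3f.
  - by case/eqP: xx'; rewrite Ex Ex'.
(* Now [#|X2| = #|K| + 2], and [squeezed_subset] will apply with [~: [set e]] as [M]. *)
have X2x : ~~ (X2 \subset x).
  case: x2' => // x2'; exfalso.
  have := subset_leq_card xM; rewrite cM.
  by clear -x2' cX2 xc T7 c1; lia.
have X2x' : ~~ (X2 \subset x').
  case: x'2' => // x'2'; exfalso.
  have := subset_leq_card x'M; rewrite cM.
  by clear -x'2' cX2 x'c T7 c1; lia.
have neM (y : {set T}) : y \subset ~: [set e] -> ~~ (X2 \subset y) ->
    #|X3| + #|T| - 5 <= #|y| \/ ~~ (X3 \subset y) -> ~~ (X3 \subset y).
  move=> yM X2y [y3|//].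
  suff Ey : y = ~: [set e] by rewrite Ey X2M in X2y.
  by apply/eqP; rewrite eqEcard yM cM; clear -y3 X3ge; lia.
have X3x := neM _ xM X2x x3; have X3x' := neM _ x'M X2x' x'3.
have X23s : X2 \subset X3.
  apply: (squeezed_subset K (~: [set e]) X2 X3 x x'); rewrite // ?cM ?cX2 ?cK.
  - by clear -x2 T7; lia.
  - by clear -x'2 T7; lia.
  - by clear; lia.
case: X23; first by rewrite X23s.
by clear -cX2 X3le; lia.
Qed.

(** * Upper bounds on the number of rounds from replies of the Arsonist *)

Lemma rounds_upto_setT {V : finType} (e : rel V) k m R :
  rounds_upto e k m setT R = 0.
Proof. by case: m => //= m; rewrite eqxx. Qed.

(** One good reply to each revealed set suffices, since further terms only lower the minimum. *)
Lemma rounds_upto_leS {V : finType} (e : rel V) k m B R d :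
    (forall S, S \in reveals k (propagate e B) R ->
       exists2 C, C \in burns (propagate e B) (R :|: S) &
         forall m, rounds_upto e k m C (R :|: S) <= d) ->
  rounds_upto e k m B R <= d.+1.
Proof.
case: m => //= m hC; case: ifP => // _; rewrite ltnS.
apply/bigmax_leqP => S /hC[C CB lC]; apply: leq_trans (lC m).
elim: index_enum (mem_index_enum C) => // D r IHr; rewrite inE big_cons.
case/predU1P=> [<-|/IHr le_r]; first by rewrite CB geq_minl.
by case: ifP; rewrite // geq_min le_r orbT.
Qed.

Lemma mem_burns {V : finType} (B R : {set V}) v :
  v \in R -> v \notin B -> v |: B \in burns B R.
Proof.
move=> vR vB; have vRB : v \in R :\: B by rewrite inE vB.
rewrite /burns ifF; first exact: imset_f.
by apply/negbTE/set0Pn; exists v.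
Qed.

Lemma burns_setT {V : finType} (R : {set V}) : setT \in burns setT R.
Proof. by rewrite /burns setDT eqxx inE. Qed.

(** The Arsonist never has to pass while a vertex is unburned: if nothing new can be revealed, that
    vertex was revealed earlier. *)
Lemma reveals_unburned {V : finType} k (B R S : {set V}) :
  0 < k -> B != setT -> S \in reveals k B R ->
  exists2 v, v \in R :|: S & v \notin B.
Proof.
move=> k0 BT; rewrite inE => /andP[SU /eqP cS].
have [/eqP U0|] := boolP (~: (B :|: R) == set0).
  have /subsetPn[v _ vB] : ~~ (setT \subset B) by rewrite subTset.
  exists v => //; have := in_set0 v; rewrite -U0 in_setC in_setU (negbTE vB) /=.
  by rewrite in_setU => /negbFE ->.
rewrite -card_gt0 => U0.
have /card_gt0P[v vS] : 0 < #|S| by rewrite cS leq_min k0.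
exists v; first by rewrite in_setU vS orbT.
by have := subsetP SU v vS; rewrite in_setC in_setU => /norP[].
Qed.

Lemma rounds_upto_le1 {V : finType} (e : rel V) k m B R : 0 < k ->
  #|~: propagate e B| <= 1 -> rounds_upto e k m B R <= 1.
Proof.
move=> k0 c1; apply: rounds_upto_leS => S SR.
suff : setT \in burns (propagate e B) (R :|: S).
  by exists setT => // m'; rewrite rounds_upto_setT.
have [->|BT] := eqVneq (propagate e B) setT; first exact: burns_setT.
have [v vRS vB] := reveals_unburned _ _ _ _ k0 BT SR.
suff <- : v |: propagate e B = setT by apply: mem_burns.
apply/eqP; rewrite -subTset -(setUCr (propagate e B)) subUset subsetUr /=.
suff -> : ~: propagate e B = [set v] by apply: subsetUl.
by apply/esym/eqP; rewrite eqEcard sub1set in_setC vB cards1.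
Qed.

(** * Histories of burned vertices *)

(* [v j] is the vertex burned in round [j.+1]; [B] is only required to contain
   what these vertices have burned after [i] rounds. *)
Definition history n i (B : {set {set 'I_n}}) (v : nat -> {set 'I_n}) :=
  (forall j l, j < l -> l < i -> l - j < dist (v j) (v l)) /\
  (forall j x, j < i -> dist (v j) x + j < i -> x \in B).

Lemma propagate_ball n (B : {set {set 'I_n}}) a j i : j < i ->
    (forall x, dist a x + j < i -> x \in B) ->
  forall x, dist a x + j < i.+1 -> x \in propagate (@hypercube n) B.
Proof.
move=> ji aB x; case Ed: (dist a x) => [|d] dj.
  move/eqP: Ed; rewrite dist_eq0 => /eqP <-.
  by apply/setUP; left; apply: aB; rewrite symdiffxx cards0.
have [y dy yx] := dist_step _ _ _ Ed.
by apply/propagate_hypercubeP; exists y; rewrite ?yx ?aB // dy.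
Qed.

(** Any unburned vertex will do: being outside the ball of radius [i - j] around each [v j] is
    exactly the required separation. *)
Lemma history_extend n i (B : {set {set 'I_n}}) v (x : {set 'I_n}) :
    history n i B v -> x \notin propagate (@hypercube n) B ->
  exists v', history n i.+1 (x |: propagate (@hypercube n) B) v'.
Proof.
case=> v_far vB xB; exists (fun j => if j == i then x else v j).
split=> [j l jl li|j y ji] /=.
  rewrite (ltn_eqF (leq_trans jl _)) //; case: eqP => [El|/eqP nl]; last first.
    by apply: v_far => //; rewrite ltn_neqAle nl.
  rewrite El in jl *; rewrite ltnNge; apply: contra xB => d.
  apply: (propagate_ball _ _ (v j) j i) => // [y|]; first exact: vB.
  by rewrite ltnS addnC -leq_subRL // ltnW.
case: eqP => [->|/eqP nj] d.
  move: d; rewrite ltnS -[leqRHS]add0n leq_add2r leqn0 dist_eq0 => /eqP <-.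
  exact: setU11.
have ji' : j < i by rewrite ltn_neqAle nj.
by apply/setU1r; apply: (propagate_ball _ _ (v j) j i) => // z; apply: vB.
Qed.

Lemma history_survivors n i (B : {set {set 'I_n}}) v (w : {set 'I_n}) j :
    history n i B v -> j < i ->
    w \notin propagate (@hypercube n) (propagate (@hypercube n) B) ->
  i.+2 - j <= dist (v j) w.
Proof.
case=> _ vB ji; apply: contraNT; rewrite -ltnNge => d.
apply: (propagate_ball _ _ (v j) j i.+1);
  [exact: ltnW| |by rewrite addnC -ltn_subRL].
by move=> x; apply: propagate_ball => // y; apply: vB.
Qed.

Lemma history_unburned n i (B : {set {set 'I_n}}) v (x : {set 'I_n}) j :
    history n i B v -> j < i -> x \notin propagate (@hypercube n) B ->
  i.+1 - j <= dist (v j) x.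
Proof.
case=> _ vB ji; apply: contraNT; rewrite -ltnNge => d.
apply: (propagate_ball _ _ (v j) j i) => // [y|]; first exact: vB.
by rewrite addnC -ltn_subRL.
Qed.

(** * The last two rounds *)

Section LastRounds.

Variables (n : nat) (B : {set {set 'I_n}}) (v : nat -> {set 'I_n}).
Hypotheses (hn : 7 <= n) (hB : history n (n - 3) B v).

(** [B1] is burned after the propagation of round [n - 2]. [B2] adds one more propagation with no
    vertex burned in between; the survivors are the vertices outside it. *)
Let B1 := propagate (@hypercube n) B.
Let B2 := propagate (@hypercube n) B1.
Let shift (x : {set 'I_n}) := symdiff x (v 0).

Let distS x y : dist (shift x) (shift y) = dist x y.
Proof. by rewrite symdiffKr. Qed.

(** A survivor is at distance at least [n - 1 - j] from [v j], which complementation turns into at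
    most [j + 1]. By [7 <= n], [v 0] to [v 3] all belong to the history. *)
Let distCw w j : j < 4 -> w \notin B2 -> dist (~: w) (v j) <= j.+1.
Proof.
move=> j4 /(history_survivors _ _ _ _ _ _ hB) h.
have := h j ltac:(clear -hn j4; lia); have := dist_setCl w (v j).
by rewrite (symdiffC w) card_ord; clear -hn j4; lia.
Qed.

Let far j l : j < l -> l < 4 -> l - j < dist (v j) (v l).
Proof. by move=> jl l4; apply: (proj1 hB) => //; clear -hn l4; lia. Qed.

Let cardS l : 0 < l -> l < 4 -> l < #|shift (v l)|.
Proof.
by move=> l0 l4; rewrite /shift symdiffC; have := far 0 l l0 l4; rewrite subn0.
Qed.

Let cardSw w : w \notin B2 -> #|shift (~: w)| <= 1.
Proof. exact: distCw 0 isT. Qed.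

Let shift_neq w w' : w != w' -> shift (~: w) != shift (~: w').
Proof.
apply: contra => /eqP E; apply/eqP/setC_inj.
by rewrite -[LHS](symdiffK _ (v 0)) -/(shift (~: w)) E symdiffK.
Qed.

Lemma card_survivors : #|~: B2| <= 2.
Proof.
rewrite leqNgt; apply/negP=> /card_gt2P[w1 [w2 [w3 [[]]]]].
rewrite !in_setC => h1 h2 h3 [n12 n23 n31].
apply: (at_most_two_candidates (shift (~: w1)) (shift (~: w2)) (shift (~: w3))
   (shift (v 1)) (shift (v 2))); rewrite ?distS ?distCw ?cardSw ?shift_neq //.
- exact: cardS.
- exact: cardS.
- exact: far.
Qed.

Lemma safe_unique w w' x x' : w \notin B2 -> w' \notin B2 -> w != w' ->
    x \notin B1 -> x' \notin B1 ->
    1 < dist w x -> 1 < dist w' x -> 1 < dist w x' -> 1 < dist w' x' ->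
  x = x'.
Proof.
move=> wB w'B ww' xB x'B wx w'x wx' w'x'.
suff E : shift x = shift x'.
  by rewrite -[LHS](symdiffK _ (v 0)) -/(shift x) E symdiffK.
apply: (at_most_one_safe (shift (~: w)) (shift (~: w'))
  (shift (v 1)) (shift (v 2)) (shift (v 3)));
  rewrite ?distS ?distCw ?cardSw ?shift_neq ?card_ord //.
1-3: exact: cardS.
1-3: exact: far.
have h y : y \notin B1 -> 1 < dist w y -> 1 < dist w' y ->
  [/\ n - 2 <= #|shift y|, n - 3 <= dist (shift (v 1)) (shift y),
      n - 4 <= dist (shift (v 2)) (shift y),
      n - 5 <= dist (shift (v 3)) (shift y)
    & dist (shift (~: w)) (shift y) <= n - 2 /\
      dist (shift (~: w')) (shift y) <= n - 2].
  move=> /(history_unburned _ _ _ _ _ _ hB) yB wy w'y; rewrite !distS.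
  have := yB 0; have := yB 1; have := yB 2; have := yB 3.
  have := dist_setCl w y; have := dist_setCl w' y.
  rewrite /shift card_ord (symdiffC y).
  by clear -hn wy w'y; split; [..|split]; lia.
by move=> y /set2P[]->; apply: h.
Qed.

Lemma rounds_upto_last m R : rounds_upto (@hypercube n) 2 m B R <= 2.
Proof.
apply: rounds_upto_leS => S SR; rewrite -/B1 in SR *.
have [B1T|B1T] := eqVneq B1 setT.
  by exists setT; rewrite ?B1T ?burns_setT // => m'; rewrite rounds_upto_setT.
have mono (x : {set 'I_n}) : B2 \subset propagate (@hypercube n) (x |: B1).
  apply/subsetP=> y /propagate_hypercubeP[z zB zy].
  by apply/propagate_hypercubeP; exists z; rewrite // setU1r.
suff [x [xRS xB cx]] : exists x, [/\ x \in R :|: S, x \notin B1 &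
    #|~: propagate (@hypercube n) (x |: B1)| <= 1].
  exists (x |: B1); first exact: mem_burns.
  by move=> m'; apply: rounds_upto_le1.
have [c1|c2] := leqP #|~: B2| 1.
  have [x xRS xB] := reveals_unburned 2 _ _ _ isT B1T SR.
  exists x; split=> //; apply: leq_trans c1.
  by apply: subset_leq_card; rewrite setCS.
have [w [w' [wB w'B ww']]] := card_gt1P c2; rewrite !in_setC in wB w'B.
have unsafe x w0 : w0 \notin B2 -> dist w0 x <= 1 ->
    #|~: propagate (@hypercube n) (x |: B1)| <= 1.
  move=> w0B w0x; rewrite -ltnS.
  apply: leq_trans card_survivors; apply: proper_card; rewrite properC.
  apply/properP; split=> //; exists w0 => //.
  by apply/propagate_hypercubeP; exists x; rewrite ?setU11 // symdiffC.
have sub12 : B1 \subset B2 by apply: subsetUl.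
(* Burning a vertex within distance 1 of a survivor eliminates it. In the other case every available
   vertex is safe for both survivors, which is refuted below. *)
have [/existsP[x /and3P[xRS xB xw]]|/existsPn safe] := boolP
    [exists x, [&& x \in R :|: S, x \notin B1 &
                   (dist w x <= 1) || (dist w' x <= 1)]].
  by exists x; split=> //; case/orP: xw; apply: unsafe.
have safeP x : x \in R :|: S -> x \notin B1 -> 1 < dist w x /\ 1 < dist w' x.
  by move=> xRS xB; have := safe x; rewrite xRS xB negb_or -!ltnNge => /andP.
(* The distance condition says that [w0] is [w] or [w']. A revealed survivor would be available at
   distance 0 from itself, so both are unrevealed, and the Saboteur has to reveal two distinct
   vertices. *)
have wU w0 : w0 \notin B2 -> dist w w0 = 0 \/ dist w' w0 = 0 ->
    w0 \in ~: (B1 :|: R).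
  move=> w0B dw; rewrite in_setC in_setU negb_or.
  have w0B1 : w0 \notin B1 by apply: contra w0B => /(subsetP sub12).
  rewrite w0B1; apply/negP=> w0R; have := safeP w0.
  rewrite in_setU w0R => /(_ isT w0B1)[].
  by case: dw => ->.
have xx0 (a : {set 'I_n}) : dist a a = 0 by rewrite symdiffxx cards0.
move: SR; rewrite inE => /andP[SU /eqP cS].
have : 1 < #|S|.
  rewrite cS leq_min /=; apply/card_gt1P; exists w, w'; split=> //.
    by apply: wU => //; left.
  by apply: wU => //; right.
case/card_gt1P=> x [x' [xS x'S xx']]; case/eqP: xx'.
have SB y : y \in S -> y \notin B1.
  by move/(subsetP SU); rewrite in_setC in_setU => /norP[].
have SRS y : y \in S -> y \in R :|: S by rewrite in_setU orbC => ->.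
have [wx w'x] := safeP x (SRS x xS) (SB x xS).
have [wx' w'x'] := safeP x' (SRS x' x'S) (SB x' x'S).
exact: (safe_unique w w' x x' wB w'B ww' (SB x xS) (SB x' x'S)).
Qed.

End LastRounds.

Lemma history_rounds n i m B R v : 7 <= n -> i <= n - 3 -> history n i B v ->
  rounds_upto (@hypercube n) 2 m B R <= n - 1 - i.
Proof.
move=> hn; move Ed: (n - 3 - i) => d.
elim: d i m B R v Ed => [|d IHd] i m B R v Ed iT hB.
  have Ei : i = n - 3 by clear -Ed iT; lia.
  rewrite Ei in hB *; have -> : n - 1 - (n - 3) = 2 by clear -hn; lia.
  exact: (rounds_upto_last _ _ _ hn hB).
have -> : n - 1 - i = (n - 1 - i.+1).+1 by clear -Ed; lia.
apply: rounds_upto_leS => S SR.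
have [BT|BT] := eqVneq (propagate (@hypercube n) B) setT.
  by exists setT; rewrite ?BT ?burns_setT // => m'; rewrite rounds_upto_setT.
have [x xRS xB] := reveals_unburned 2 _ _ _ isT BT SR.
exists (x |: propagate (@hypercube n) B); first exact: mem_burns.
have [v' hB'] := history_extend _ _ _ _ _ hB xB.
by move=> m'; apply: IHd hB'; clear -Ed; lia.
Qed.

Theorem theorem5 (n : nat) (hn : 7 <= n) :
  liminal_burning_number (@hypercube n) 2 = n - 1.
Proof.
apply/eqP; rewrite eqn_leq liminal_burning_number_ge ?andbT; last first.
  by apply: leq_trans hn.
(* Before the first round the history is empty, so any sequence serves. *)
rewrite -[n - 1]subn0; apply: (history_rounds _ _ _ _ _ (fun=> set0)) => //.
Qed.
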